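(* For any bounded graph $\mathfrak{F}=\langle W,R\rangle$, any set $I$ and any ultrafilter $D$ over $I$, we have $\Lambda(\mathfrak{F})=\Lambda(\mathfrak{F}^{\mathfrak{ue}})=\Lambda({}^I\mathfrak{F}/D)$.
   Context: A directed graph is bounded if there is $m\in\omega$ such that every vertex $w$ satisfies $|\{s:Rws\}|+|\{s:Rsw\}|\leq m$. The ultrafilter extension is $\mathfrak{F}^{\mathfrak{ue}}=\langle\mathrm{Uf}(W),R^{\mathfrak{ue}}\rangle$, with $\mathrm{Uf}(W)$ the set of ultrafilters over $W$ and $R^{\mathfrak{ue}}uv$ iff $\{w:\exists s\,(Rws\wedge s\in X)\}\in u$ for every $X\in v$. ${}^I\mathfrak{F}/D$ is the ultrapower. For a frame (directed graph) $\mathfrak{G}$, $\Lambda(\mathfrak{G})$ is the set of formulas of the basic propositional modal language (propositional variables, Boolean connectives and one unary modality $\diamondsuit$, interpreted by $w\Vdash\diamondsuit\varphi$ iff some $R$-successor of $w$ satisfies $\varphi$) that are true at every point of $\mathfrak{G}$ under every valuation. *)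

(* Defs.v *)
From mathcomp Require Import all_boot.
From mathcomp Require Import boolp classical_sets functions cardinality filter.

Set Implicit Arguments.
Unset Strict Implicit.
Unset Printing Implicit Defensive.

Local Open Scope classical_set_scope.
Local Open Scope card_scope.

Record frame := Frame { world :> Type; acc : world -> world -> Prop }.

Definition bounded (F : frame) : Prop :=
  exists m : nat, forall w : F, exists a b : nat,
    [/\ [set s | acc w s] #= `I_a, [set s | acc s w] #= `I_b & a + b <= m].

Definition ultrafilter_on (W : Type) : Type :=
  {u : set_system W | UltraFilter u}.

Definition ultrafilter_ext (F : frame) : frame :=
  @Frame (ultrafilter_on F) (fun u v =>
    forall X : set F, sval v X ->
      sval u [set w | exists s, acc w s /\ X s]).

Definition ultra_class (I W : Type) (D : set_system I) (f : I -> W) :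
    set (I -> W) :=
  [set g | D [set i | f i = g i]].

Definition ultrapower_world (I W : Type) (D : set_system I) : Type :=
  {c : set (I -> W) | exists f, c = ultra_class D f}.

(* When D is a filter the truth of the relation does not depend on the choice
   of representatives: see ultrapower_accE. *)
Definition ultrapower (I : Type) (D : set_system I) (F : frame) : frame :=
  @Frame (ultrapower_world F D) (fun c d =>
    exists f g : I -> F,
      [/\ sval c = ultra_class D f, sval d = ultra_class D g
        & D [set i | acc (f i) (g i)]]).

Definition to_ultrapower (I : Type) (D : set_system I) (F : frame)
    (f : I -> F) : ultrapower D F :=
  exist _ (ultra_class D f) (ex_intro _ f erefl).

Lemma ultra_class_eq (I W : Type) (D : set_system I) (f g : I -> W) :
  Filter D -> (ultra_class D f = ultra_class D g) <-> D [set i | f i = g i].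
Proof.
move=> FD; split=> [fg | fg].
  suff : ultra_class D f g by [].
  by rewrite fg /ultra_class /=; apply: filterS filterT.
apply/seteqP; split=> h hh; rewrite /ultra_class /=.
  by apply: filterS (filterI fg hh) => i /= [-> ->].
by apply: filterS (filterI fg hh) => i /= [-> ->].
Qed.

Lemma ultrapower_accE (I : Type) (D : set_system I) (F : frame)
    (f g : I -> F) : Filter D ->
  acc (to_ultrapower D f) (to_ultrapower D g) <-> D [set i | acc (f i) (g i)].
Proof.
move=> FD; split=> [[f' [g' /= [/ultra_class_eq ff' /ultra_class_eq gg' fg']]] |].
  by apply: filterS (filterI (filterI ff' gg') fg') => i /= [[-> ->]].
by move=> fg; exists f, g; split.
Qed.

Inductive formula : Type :=
  | Var of nat
  | Bot
  | Neg of formula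
  | And of formula & formula
  | Or of formula & formula
  | Imp of formula & formula
  | Dia of formula.

Fixpoint sat (F : frame) (V : nat -> set F) (w : F) (phi : formula) : Prop :=
  match phi with
  | Var p => V p w
  | Bot => False
  | Neg a => ~ sat V w a
  | And a b => sat V w a /\ sat V w b
  | Or a b => sat V w a \/ sat V w b
  | Imp a b => sat V w a -> sat V w b
  | Dia a => exists2 s, acc w s & sat V s a
  end.

Definition Lambda (F : frame) : set formula :=
  [set phi | forall (V : nat -> set F) (w : F), sat V w phi].

(* Main.v *)
Require Import Defs.
From mathcomp Require Import all_boot.
From mathcomp Require Import boolp classical_sets functions cardinality filter.

(** A bound [k] on the out-degrees lets us write the accessibility relation as
    the union of [k] partial functions [f i], and each [f i] extends to a partial
    function on ultrafilters and on the ultrapower; as ultrafilters are prime for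
    finite unions, these extensions again cover the accessibility relation.
    Truth at [u] of a formula of modal depth [n] depends only on the points
    reached from [u] by words of length at most [n] in the [f i].  There are
    finitely many such words, so some point [w] of the original frame has the same
    words defined, with every coincidence of endpoints at [w] holding at [u] too:
    any valuation can then be pulled back from the neighbourhood of [u] to the one
    of [w].  Conversely the original frame embeds as a generated subframe, through
    principal ultrafilters or constant functions. *)

Set Implicit Arguments.
Unset Strict Implicit.
Unset Printing Implicit Defensive.

Local Open Scope classical_set_scope.

(** * Covering the accessibility relation by partial functions *)

Definition branches (F : frame) (k : nat) (f : 'I_k -> F -> option F) : Prop :=
  forall w s, acc w s <-> exists i, f i w = Some s.

Definition run (W : Type) (k : nat) (f : 'I_k -> W -> option W)
    (sigma : seq 'I_k) (w : W) : option W :=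
  foldl (fun o i => obind (f i) o) (Some w) sigma.

Lemma run_rcons (W : Type) (k : nat) (f : 'I_k -> W -> option W) sigma i w :
  run f (rcons sigma i) w = obind (f i) (run f sigma w).
Proof. by rewrite /run foldl_rcons. Qed.

(** The successors of each [w] are numbered injectively below [m]; branch [i] sends [w] to its
    successor number [i], if there is one. *)
Lemma bounded_branches (F : frame) : bounded F ->
  exists (k : nat) (f : 'I_k -> F -> option F), branches f.
Proof.
case=> m bF; exists m.
have /choice[g gP] : forall w : F, exists g : 'I_m -> option F,
    forall s, acc w s <-> exists i, g i = Some s.
  move=> w; have [a [b [/card_set_bijP[e [efun einj esurj]] _ abm]]] := bF w.
  have am : a <= m by apply: leq_trans abm; exact: leq_addr.
  have /choice[g gP] : forall i : 'I_m, exists o : option F,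
      forall s, o = Some s <-> acc w s /\ e s = i.
    move=> i; have [[s [ws es]]|nos] := pselect (exists s, acc w s /\ e s = i).
      exists (Some s) => t; split=> [[<-]//|[wt et]].
      by congr Some; apply: einj; rewrite ?inE//= es et.
    by exists None => s; split=> // ws; case: nos; exists s.
  exists g => s; split=> [ws|[i /gP[]]//].
  exists (Ordinal (leq_trans (efun _ ws) am)).
  exact/gP.
by exists (fun i w => g w i) => w s; exact: gP.
Qed.

(** * Transfer of validity between frames covered by branches *)

Fixpoint depth (phi : formula) : nat :=
  match phi with
  | Var _ | Bot => 0
  | Neg a => depth a
  | And a b | Or a b | Imp a b => maxn (depth a) (depth b)
  | Dia a => (depth a).+1
  end.

(** The valuation around [u] is copied to [w] along words. Coincidences need to pass only from [w]
    to [u], for the copy to be consistent; the equivalence on undefined runs matches the successors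
    in both directions. *)
Lemma sub_Lambda (F G : frame) (k : nat) (f : 'I_k -> F -> option F)
    (g : 'I_k -> G -> option G) :
  branches f -> branches g ->
  (forall (u : G) n, exists w : F, forall sigma tau,
    size sigma <= n -> size tau <= n ->
    (run f sigma w = None <-> run g sigma u = None) /\
    (run f sigma w = run f tau w -> run g sigma u = run g tau u)) ->
  Lambda F `<=` Lambda G.
Proof.
move=> fP gP fg phi Fphi V u.
have [w wu] := fg u (depth phi); set n := depth phi in wu.
pose V' p : set F := [set x | exists tau y, [/\ size tau <= n,
  run f tau w = Some x, run g tau u = Some y & V p y]].
(* Each [Dia] costs one more letter, so the word already read and the remaining depth share the
   budget [n]. *)
suff agree psi : forall sigma x y, size sigma + depth psi <= n ->
    run f sigma w = Some x -> run g sigma u = Some y ->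
    sat V' x psi <-> sat V y psi.
  by apply/(agree phi [::] w u) => //; exact: Fphi.
elim: psi => [p||a IHa|a IHa b IHb|a IHa b IHb|a IHa b IHb|a IHa] sigma x y /=.
- rewrite addn0 => szn fx gy; split=> [[tau [y' [tn ftx gty' Vy']]]|Vy].
    (* The point [x] may lie in [V' p] because of another word [tau]; the coincidence of [sigma] and
       [tau] at [w] carries over to [u] and gives [y = y']. *)
    have [_] := wu _ _ szn tn; rewrite fx ftx gy gty' => /(_ erefl)[->].
    exact: Vy'.
  by exists sigma, y.
- by [].
- by move=> szn fx gy; have := IHa _ _ _ szn fx gy; tauto.
- rewrite addn_maxr geq_max => /andP[sa sb] fx gy.
  by have := IHa _ _ _ sa fx gy; have := IHb _ _ _ sb fx gy; tauto.
- rewrite addn_maxr geq_max => /andP[sa sb] fx gy.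
  by have := IHa _ _ _ sa fx gy; have := IHb _ _ _ sb fx gy; tauto.
- rewrite addn_maxr geq_max => /andP[sa sb] fx gy.
  by have := IHa _ _ _ sa fx gy; have := IHb _ _ _ sb fx gy; tauto.
- rewrite addnS => szn fx gy.
  have srn i : size (rcons sigma i) + depth a <= n by rewrite size_rcons.
  have sr i : size (rcons sigma i) <= n.
    by apply: leq_trans (srn i); exact: leq_addr.
  have frE i : run f (rcons sigma i) w = f i x by rewrite run_rcons fx.
  have grE i : run g (rcons sigma i) u = g i y by rewrite run_rcons gy.
  split=> -[s].
    move=> /fP[i fis] sa; case git : (g i y) => [t|].
      exists t; first by apply/gP; exists i.
      by apply/(IHa (rcons sigma i) s t); rewrite ?frE ?grE.
    by have [[_]] := wu _ _ (sr i) (sr i); rewrite frE grE git fis => /(_ erefl).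
  move=> /gP[i gis] sa; case fit : (f i x) => [t|].
    exists t; first by apply/fP; exists i.
    by apply/(IHa (rcons sigma i) t s); rewrite ?frE ?grE.
  by have [[+ _]] := wu _ _ (sr i) (sr i); rewrite frE grE gis fit => /(_ erefl).
Qed.

(** Runs commute with [e], so [e u] has the same words defined as [u], and injectivity brings
    coincidences back. *)
Lemma sub_Lambda_embedding (F G : frame) (k : nat) (f : 'I_k -> F -> option F)
    (g : 'I_k -> G -> option G) (e : F -> G) :
  branches f -> branches g -> injective e ->
  (forall i w, g i (e w) = omap e (f i w)) ->
  Lambda G `<=` Lambda F.
Proof.
move=> fP gP einj geE; apply: (sub_Lambda gP fP) => u n; exists (e u).
have runE sigma : run g sigma (e u) = omap e (run f sigma u).
  elim/last_ind: sigma => //= sigma i IH.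
  by rewrite !run_rcons IH; case: (run f sigma u) => //= x; exact: geE.
move=> sigma tau _ _; rewrite !runE.
case: (run f sigma u) => [x|]; case: (run f tau u) => [y|] //=.
by split=> // -[/einj ->].
Qed.

(** A total version of [h], along which ultrafilters can be pushed forward; the default is harmless
    when [h] is defined almost everywhere. *)
Definition step (W : Type) (h : W -> option W) (x : W) : W := odflt x (h x).

Lemma ultra_setC (T : Type) (E : set_system T) (A : set T) :
  UltraFilter E -> ~ E A -> E (~` A).
Proof. by move=> UE nEA; have [] := in_ultra_setVsetC A UE. Qed.

(* [tracks h x] reads: [x] is the class modulo [E] of the family [h].  The
   family [h] itself serves as default value where a branch is undefined. *)
Lemma sub_Lambda_tracking (F G : frame) (k : nat) (f : 'I_k -> F -> option F)
    (g : 'I_k -> G -> option G) :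
  branches f -> branches g ->
  (forall u : G, exists (J : Type) (E : set_system J)
      (tracks : (J -> F) -> G -> Prop),
    [/\ UltraFilter E, exists h, tracks h u,
      forall h x i, tracks h x ->
        (E [set j | f i (h j) = None] -> g i x = None) /\
        (E [set j | f i (h j) <> None] ->
          exists2 y, g i x = Some y & tracks (step (f i) \o h) y) &
      forall h h' x x', tracks h x -> tracks h' x' -> x <> x' ->
        E [set j | h j <> h' j]]) ->
  Lambda F `<=` Lambda G.
Proof.
move=> fP gP trG; apply: (sub_Lambda fP gP) => u n.
have [J [E [tr [UE [h hu] trg trne]]]] := trG u.
(* A dichotomy in the style of Łoś: each run is undefined at [u] and almost everywhere, or its
   endpoint at [u] is tracked by a family of endpoints. *)
have runP sigma :
    (E [set j | run f sigma (h j) = None] /\ run g sigma u = None) \/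
    (exists h' y, [/\ E [set j | run f sigma (h j) = Some (h' j)],
       run g sigma u = Some y & tr h' y]).
  elim/last_ind: sigma => [|sigma i [[EN gN]|[h' [y [ES gS try]]]]].
  - by right; exists h, u; split=> //; apply: filterS filterT.
  - left; rewrite run_rcons gN; split=> //; apply: filterS EN => j /= fN.
    by rewrite run_rcons fN.
  - have [gN gS'] := trg h' y i try.
    have [EN|/(ultra_setC UE) EnN] := pselect (E [set j | f i (h' j) = None]).
      left; rewrite run_rcons gS; split; last exact: gN.
      by apply: filterS (filterI ES EN) => j /= [fj fN]; rewrite run_rcons fj.
    have [z giz trz] := gS' EnN; right; exists (step (f i) \o h'), z.
    split=> //; last by rewrite run_rcons gS.
    apply: filterS (filterI ES EnN) => j /= [fj]; rewrite run_rcons fj /step /=.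
    by case: (f i (h' j)).
pose good (sigma tau : seq 'I_k) : set J := [set j |
  (run f sigma (h j) = None <-> run g sigma u = None) /\
  (run f sigma (h j) = run f tau (h j) -> run g sigma u = run g tau u)].
have goodE sigma tau : E (good sigma tau).
  have [[EN gN]|[h1 [y1 [ES gS tr1]]]] := runP sigma;
      have [[EN' gN']|[h2 [y2 [ES' gS' tr2]]]] := runP tau.
  - apply: filterS EN => j /= sN; rewrite /good /= gN gN' sN; tauto.
  - apply: filterS (filterI EN ES') => j /= [sN tS].
    by rewrite /good /= gN gS' sN tS.
  - apply: filterS (filterI ES EN') => j /= [sS tN].
    by rewrite /good /= gS gN' sS tN.
  - have [y12|y12] := pselect (y1 = y2).
      by apply: filterS ES => j /= sS; rewrite /good /= gS gS' sS y12.
    (* Distinct endpoints at [u] are tracked by families that differ almost everywhere, where the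
       premise on coincidence therefore fails. *)
    apply: filterS (filterI (filterI ES ES') (trne _ _ _ _ tr1 tr2 y12)).
    by move=> j /= [[sS tS] ne]; rewrite /good /= gS gS' sS tS; split=> // -[].
(* Words of length at most [n] form a finite type, so the intersection of all these sets [good] is
   still in [E], hence inhabited. *)
have : E [set j | forall st : n.-bseq 'I_k * n.-bseq 'I_k, good st.1 st.2 j].
  by apply: filter_forall => st; exact: goodE.
case/filter_ex => j jP; exists (h j) => sigma tau ssz tsz.
exact: (jP (Bseq ssz, Bseq tsz)).
Qed.

(** * The ultrafilter extension *)

Lemma fmap_ultra (T U : Type) (h : T -> U) (E : set_system T) :
  UltraFilter E -> UltraFilter (fmap h E).
Proof.
move=> UE; split=> [|G PG EG]; first exact: fmap_proper_filter.
apply/seteqP; split=> // A GA; apply: contrapT => /(ultra_setC UE) nA.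
by have [x []] := filter_ex (filterI GA (EG (~` A) nA)).
Qed.

Definition ue_map (W : Type) (h : W -> W) (u : ultrafilter_on W) :
  ultrafilter_on W := exist _ _ (fmap_ultra h (svalP u)).

Definition ue_branch (F : frame) (k : nat) (f : 'I_k -> F -> option F) (i : 'I_k)
    (u : ultrafilter_ext F) : option (ultrafilter_ext F) :=
  if `[< sval u [set w | f i w <> None] >] then Some (ue_map (step (f i)) u)
  else None.

(** Otherwise [u] would be included in [v], and equal to it by maximality. *)
Lemma ue_neq (W : Type) (u v : ultrafilter_on W) :
  u <> v -> exists X, sval u X /\ sval v (~` X).
Proof.
case: u v => [u Uu] [v Uv] /= uv; apply: contrapT => /forallNP uX; apply: uv.
apply: eq_exist; apply/esym/(@max_filter _ _ Uu).
by move=> X uX'; apply: contrapT => /(ultra_setC Uv) vX; case: (uX X).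
Qed.

(** If [v] is the value of no branch, each [i] gives a set in [v] that [f i] avoids [u]-almost
    everywhere; the finite intersection of these sets contradicts accessibility. Conversely,
    [step (f i)] yields true successors wherever [f i] is defined. *)
Lemma ue_branches (F : frame) (k : nat) (f : 'I_k -> F -> option F) :
  branches f -> branches (@ue_branch F k f).
Proof.
move=> fP u v; have Uu := svalP u; have Uv := svalP v; split=> [uv|[i]].
  apply: contrapT => /forallNP noi.
  have /choice[X XP] : forall i, exists X, sval v X /\
      sval u [set w | forall s, f i w = Some s -> ~ X s].
    move=> i; have := noi i; rewrite /ue_branch; case: asboolP => [ui ne|ui _].
      have [X [vX uX]] : exists X, sval v X /\
          sval u (step (f i) @^-1` (~` X)).
        by apply: (@ue_neq _ v (ue_map _ u)) => vE; apply: ne; rewrite vE.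
      exists X; split=> //; apply: filterS uX => w /=; rewrite /step.
      by case: (f i w) => //= t Xt s [<-].
    (* Here [f i] is undefined almost everywhere, so it avoids any set. *)
    exists setT; split; first exact: filterT.
    apply: filterS (ultra_setC Uu ui) => w /= fiw s fs; case: fiw.
    by rewrite fs.
  have vX : sval v [set s | forall i, X i s].
    by apply: filter_forall => i; case: (XP i).
  have uX : sval u [set w | forall i s, f i w = Some s -> ~ X i s].
    by apply: filter_forall => i; case: (XP i).
  have [w [/= [s [/fP[i fis] Xs]] nX]] := filter_ex (filterI (uv _ vX) uX).
  exact: nX fis (Xs i).
rewrite /ue_branch; case: asboolP => // ui [<-] X uX.
apply: filterS (filterI ui uX) => w /= []; rewrite /step.
case fiw : (f i w) => [s|] //= _ Xs; exists s; split=> //.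
by apply/fP; exists i.
Qed.

Lemma Lambda_ue (F : frame) (k : nat) (f : 'I_k -> F -> option F) :
  branches f -> Lambda F = Lambda (ultrafilter_ext F).
Proof.
move=> fP; have gP := ue_branches fP; apply/seteqP; split.
  apply: (sub_Lambda_tracking fP gP) => u; have Uu := svalP u.
  (* A family indexed by [F] tracks the image of [u] under it; the identity tracks [u] itself. *)
  exists F, (sval u), (fun h v => v = ue_map h u); split=> //.
  - by exists id; case: u {Uu} => u Uu; apply: eq_exist.
  - move=> h _ i ->; rewrite /ue_branch; case: asboolP => /= ui; split=> // uN.
    + by have [w [/= fN []]] := filter_ex (filterI uN ui).
    + by exists (ue_map (step (f i)) (ue_map h u)) => //; apply: eq_exist.
  - move=> h h' _ _ -> -> /ue_neq[X [uX uX']].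
    have {}uX : sval u (h @^-1` X) := uX.
    have {}uX' : sval u (h' @^-1` (~` X)) := uX'.
    apply: filterS (filterI uX uX') => w /= [Xw nXw] hE.
    by apply: nXw; rewrite -hE.
pose e (w : F) : ultrafilter_ext F := exist _ _ (principal_filter_ultra w).
apply: (@sub_Lambda_embedding _ _ _ f (@ue_branch F k f) e) => //.
  move=> x y /(congr1 sval) /= xy.
  have : principal_filter x [set x] by apply/principal_filterP.
  by rewrite xy => /principal_filterP.
move=> i w; rewrite /ue_branch; case: asboolP => /= /principal_filterP.
  rewrite /=; case fiw : (f i w) => [s|] //= _; congr Some; apply: eq_exist.
  apply/seteqP; split=> X /principal_filterP Xs; apply/principal_filterP;
    by move: Xs; rewrite /= /step fiw.
by move=> /contrapT ->.
Qed.

(** * The ultrapower *)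

Section Ultrapower.

Variables (F : frame) (k : nat) (f : 'I_k -> F -> option F).
Variables (I : Type) (D : set_system I).
Hypotheses (fP : branches f) (UD : UltraFilter D).

Definition representative (c : ultrapower D F) : I -> F := sval (cid (svalP c)).

Lemma representativeP (c : ultrapower D F) :
  sval c = ultra_class D (representative c).
Proof. exact: svalP (cid (svalP c)). Qed.

Definition up_branch (i : 'I_k) (c : ultrapower D F) : option (ultrapower D F) :=
  let h := representative c in
  if `[< D [set j | f i (h j) <> None] >]
  then Some (to_ultrapower D (step (f i) \o h)) else None.

(** Together with [up_branch_None], this frees [up_branch] from the chosen representative. *)
Lemma up_branch_Some (c : ultrapower D F) h i : sval c = ultra_class D h ->
  D [set j | f i (h j) <> None] ->
  up_branch i c = Some (to_ultrapower D (step (f i) \o h)).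
Proof.
rewrite representativeP /up_branch; set r := representative c.
move=> /ultra_class_eq rh Di.
case: asboolP => [_|[]]; last by apply: filterS (filterI rh Di) => j /= [->].
congr Some; apply: eq_exist; apply/ultra_class_eq.
by apply: filterS rh => j /= ->.
Qed.

Lemma up_branch_None (c : ultrapower D F) h i : sval c = ultra_class D h ->
  D [set j | f i (h j) = None] -> up_branch i c = None.
Proof.
rewrite representativeP /up_branch; set r := representative c.
move=> /ultra_class_eq rh Di; case: asboolP => // Dr.
by have [j [[/= -> ->]]] := filter_ex (filterI (filterI rh Di) Dr).
Qed.

Lemma up_branches : branches up_branch.
Proof.
move=> c d; split=> [[h [h' [ch dh' hh']]]|[i]].
  (* The branch used may vary with [j]; as there are finitely many, one index serves [D]-almost
     everywhere. *)
  have [i Di] : exists i, D [set j | f i (h j) = Some (h' j)].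
    apply: contrapT => /forallNP noi.
    have Dn : D [set j | forall i, f i (h j) <> Some (h' j)].
      by apply: filter_forall => i; exact: ultra_setC (noi i).
    by have [j [/= /fP[i fi] /(_ i)]] := filter_ex (filterI hh' Dn).
  exists i; rewrite (up_branch_Some ch).
    congr Some; case: d dh' => d dP /= dh'; apply: eq_exist; rewrite dh'.
    by apply/ultra_class_eq; apply: filterS Di => j /=; rewrite /step => ->.
  by apply: filterS Di => j /= ->.
rewrite /up_branch; set r := representative c; case: asboolP => // Di [<-].
exists r, (step (f i) \o r); split=> //; first exact: representativeP.
apply: filterS Di => j /=; rewrite /step; case fi : (f i (r j)) => [s|] //= _.
by apply/fP; exists i.
Qed.

Lemma Lambda_ultrapower : Lambda F = Lambda (ultrapower D F).
Proof.
apply/seteqP; split.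
  apply: (sub_Lambda_tracking fP up_branches) => c.
  exists I, D, (fun h d => sval d = ultra_class D h); split=> //.
  - by exists (representative c); exact: representativeP.
  - move=> h d i dh; split=> [|Di]; first exact: up_branch_None.
    by exists (to_ultrapower D (step (f i) \o h)) => //; exact: up_branch_Some.
  - move=> h h' [d dP] [d' dP'] /= dh dh' dd'; apply: ultra_setC => hh'.
    by apply: dd'; apply: eq_exist; rewrite dh dh'; apply/ultra_class_eq.
apply: (@sub_Lambda_embedding _ _ _ f up_branch
  (fun w => to_ultrapower D (fun=> w))) => //; first exact: up_branches.
  by move=> x y /(congr1 sval) /= /ultra_class_eq /filter_ex[].
move=> i w; case fiw : (f i w) => [s|] /=.
  rewrite (@up_branch_Some _ (fun=> w))//; last first.
    by apply: filterS filterT => j _ /=; rewrite fiw.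
  by congr Some; congr to_ultrapower; apply/funext => j; rewrite /= /step fiw.
by rewrite (@up_branch_None _ (fun=> w))//; apply: filterS filterT.
Qed.

End Ultrapower.

Theorem theorem4p5 (F : frame) (hF : bounded F) (I : Type)
    (D : set_system I) (hD : UltraFilter D) :
  Lambda F = Lambda (ultrafilter_ext F) /\
  Lambda (ultrafilter_ext F) = Lambda (ultrapower D F).
Proof.
have [k [f fP]] := bounded_branches hF.
by rewrite -(Lambda_ue fP); split=> //; exact: (Lambda_ultrapower fP hD).
Qed.
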